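(* Let $M,N\ge 0$ be real numbers and let $n\ge 0$ be an integer. For $i,r=0,1,\dots,n$ put $$ \begin{aligned} M_{i,r}^{n}=&\binom{n}{i}^{-1}\frac{(2r)!}{2^{2r}(r!)^{2}}\sum_{k=\max(0,i+r-n)}^{\min(i,r)}(-1)^{r-k}\binom{n-r}{i-k}\binom{r-\frac12}{k}\binom{r-\frac12}{r-k}\\ &+\sum_{k=0}^{r}\lambda_{k}\binom{n}{i}^{-1}\frac{(2k)!}{2^{2k}(k!)^{2}}\sum_{j=\max(0,i+k-n)}^{\min(i,k)}(-1)^{k-j}\binom{n-k}{i-j}\binom{k-\frac12}{j}\binom{k-\frac12}{k-j}. \end{aligned} $$ Then $(M_{i,r}^{n})_{0\le i,r\le n}$ is the matrix transforming coefficients with respect to the generalized Chebyshev-I polynomials $\mathscr{T}_0^{(M,N)},\dots,\mathscr{T}_n^{(M,N)}$ into coefficients with respect to the Bernstein basis of degree $n$: whenever $$p_n(x)=\sum_{i=0}^{n}d_i\,\mathscr{T}_i^{(M,N)}(x)=\sum_{r=0}^{n}c_r\,B_r^{n}(x)$$ with real coefficients $d_i$, $c_r$, one has $$c_i=\sum_{r=0}^{n}M_{i,r}^{n}\,d_r,\qquad i=0,1,\dots,n.$$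
   Context: The Bernstein polynomials of degree $n$ are $B_k^n(x)=\binom{n}{k}x^k(1-x)^{n-k}$ for $k=0,1,\dots,n$, $x\in[0,1]$. For real $a$ and an integer $k\ge0$, $\binom{a}{k}=\frac{a(a-1)\cdots(a-k+1)}{k!}$. For real $M,N\ge0$ and integers $k\ge 0$, $$\lambda_k=\frac{4M}{(2k-3)(k-1)!}+\frac{4N}{(2k-3)(k-1)!}+\frac{4MN}{(k-1)!\,(k-2)!},$$ with the convention $1/m!=0$ for negative integers $m$. Chebyshev polynomials of the first kind: $T_k$ is taken on $[0,1]$ and normalized so that its Bernstein form is $$T_k(x)=\sum_{i=0}^{k}(-1)^{k-i}\eta_{i,k}B_i^k(x),\qquad \eta_{i,k}=\frac{\binom{2k}{k}\binom{2k}{2i}}{2^{2k}\binom{k}{i}}\quad(0\le i\le k);$$ equivalently, $T_k(x)=2^{-2k}\binom{2k}{k}\cos(k\theta)$ where $2x-1=\cos\theta$. Double factorials: $(2n)!!=2^n n!$ and $(2n-1)!!=(2n)!/(2^n n!)$, with $0!!=(-1)!!=1$. The generalized Chebyshev-I Koornwinder's type polynomials (generalized Chebyshev-I polynomials) are $$\mathscr{T}_n^{(M,N)}(x)=\frac{(2n-1)!!}{(2n)!!}T_n(x)+\sum_{k=0}^{n}\frac{(2k)!\,\lambda_k}{2^{2k}(k!)^2}T_k(x),\qquad n=0,1,2,\dots,$$ so that $$\mathscr{T}_{r}^{(M,N)}(x)=\frac{(2r-1)!!}{(2r)!!}\sum_{i=0}^{r}(-1)^{r-i}\eta_{i,r}B_{i}^{r}(x)+\sum_{k=0}^{r}\frac{(2k)!\lambda_{k}}{2^{2k}(k!)^{2}}\sum_{j=0}^{k}(-1)^{k-j}\eta_{j,k}B_{j}^{k}(x).$$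 *)

(* Defs.v *)
From HB Require Import structures.
From mathcomp Require Import all_boot all_order all_algebra.
From mathcomp Require Import reals.
Set Implicit Arguments. Unset Strict Implicit. Unset Printing Implicit Defensive.
Import Order.TTheory GRing.Theory Num.Theory.
Local Open Scope ring_scope.

Section Koornwinder.
Variable R : realType.

(* B_k^n *)
Definition bernstein (n k : nat) : {poly R} :=
  'C(n, k)%:R *: ('X^k * (1 - 'X) ^+ (n - k)).

(* binom(a, k) = a (a - 1) ... (a - k + 1) / k! for real a *)
Definition rbinom (a : R) (k : nat) : R :=
  (\prod_(j < k) (a - j%:R)) / k`!%:R.

(* 1/m!, with the convention 1/m! = 0 for m < 0 *)
Definition invfact (m : int) : R :=
  if m is Posz p then (p`!%:R)^-1 else 0.

Definition lambda (M N : R) (k : nat) : R :=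
  4 * M / (2 * k%:R - 3) * invfact (k%:Z - 1)
  + 4 * N / (2 * k%:R - 3) * invfact (k%:Z - 1)
  + 4 * M * N * invfact (k%:Z - 1) * invfact (k%:Z - 2).

Definition eta (i k : nat) : R :=
  'C(2 * k, k)%:R * 'C(2 * k, 2 * i)%:R / (2 ^+ (2 * k) * 'C(k, i)%:R).

(* Shifted to [0, 1] and normalized:
   T_k(x) = 2^(-2k) 'C(2k, k) cos(k theta), where 2 x - 1 = cos theta. *)
Definition chebT (k : nat) : {poly R} :=
  \sum_(i < k.+1) ((-1) ^+ (k - i) * eta i k) *: bernstein k i.

(* (2n)!! and (2n - 1)!! *)
Definition evendfact (n : nat) : R := 2 ^+ n * n`!%:R.
Definition odddfact (n : nat) : R := (2 * n)`!%:R / (2 ^+ n * n`!%:R).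

Definition gchebT (M N : R) (n : nat) : {poly R} :=
  (odddfact n / evendfact n) *: chebT n
  + \sum_(k < n.+1)
      ((2 * k)`!%:R * lambda M N k / (2 ^+ (2 * k) * k`!%:R ^+ 2)) *: chebT k.

(* Entries M_{i,r}^n. The lower summation bounds i + r - n and i + k - n are
   truncated subtractions, i.e., max(0, i + r - n) and max(0, i + k - n). *)
Definition transmx (M N : R) (n : nat) : 'M[R]_n.+1 :=
  \matrix_(i < n.+1, r < n.+1)
   ('C(n, i)%:R^-1 * ((2 * r)`!%:R / (2 ^+ (2 * r) * r`!%:R ^+ 2))
    * (\sum_(i + r - n <= k < (minn i r).+1)
        (-1) ^+ (r - k) * 'C(n - r, i - k)%:R
        * rbinom (r%:R - 2^-1) k * rbinom (r%:R - 2^-1) (r - k))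
    + \sum_(k < r.+1)
        lambda M N k * 'C(n, i)%:R^-1
        * ((2 * k)`!%:R / (2 ^+ (2 * k) * k`!%:R ^+ 2))
        * (\sum_(i + k - n <= j < (minn i k).+1)
            (-1) ^+ (k - j) * 'C(n - k, i - j)%:R
            * rbinom (k%:R - 2^-1) j * rbinom (k%:R - 2^-1) (k - j))).

End Koornwinder.

(* Main.v *)
Require Import Defs.
From mathcomp Require Import all_boot all_order all_algebra.
From mathcomp Require Import reals.
From mathcomp Require Import ring zify.
Import Order.TTheory GRing.Theory Num.Theory.
Local Open Scope ring_scope.

(** Both sides of the claim are coordinates of one polynomial in the Bernstein
    basis of degree [n], so it suffices to expand each generalized Chebyshev
    polynomial in that basis and to compare coordinates.

    The expansion has two ingredients.  Multiplying [x^j (1 - x)^(k - j)] by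
    [1 = (x + (1 - x))^(n - k)] and expanding by the binomial theorem raises
    the degree of a Bernstein polynomial from [k] to [n]
    ([bernstein_elevation]).  The half-integer binomials of the matrix come
    from [eta_mul_bin]: the weight ['C(k, j)] produced by degree elevation
    turns [eta j k] into a product of two binomials with upper entry
    [k - 1/2], because each of these is, up to powers of two, a quotient of
    double factorials ([rbinom_half]).  Substituting both into the Bernstein
    form of the Chebyshev polynomials gives [chebT_bernstein], and linearity
    gives [gchebT_bernstein].

    Coordinates can be compared because two polynomials that agree on [[0, 1]]
    are equal ([eq_poly01]) and because the Bernstein basis is triangular with
    respect to the order of vanishing at [0] ([bernstein_free]). *)

Section HalfInteger.
Variable R : realType.

Let factR_neq0 (m : nat) : (m`!%:R : R) != 0.
Proof. by rewrite pnatr_eq0 -lt0n fact_gt0. Qed.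

(** Stepping from [j] to [j + 1] multiplies the left side by
    [(k - j - 1/2) / (j + 1)].  On the right, [(2 (k - j))!] loses the factors
    [2 (k - j)] and [2 (k - j) - 1]; the loss of [k - j] in [(k - j)!] and the
    new factor [4] leave [(2 (k - j) - 1) / 2], which is the same. *)
Lemma rbinom_half (k j : nat) : (j <= k)%N ->
  rbinom (k%:R - 2^-1 : R) j =
  (2 * k)`!%:R * (k - j)`!%:R
    / (2 ^+ (2 * j) * k`!%:R * (2 * (k - j))`!%:R * j`!%:R).
Proof.
elim: j => [|j IHj] lejk.
  rewrite /rbinom big_ord0 subn0 muln0 expr0 fact0; field.
  by rewrite !factR_neq0.
have [m km] : exists m, k = (j + m.+1)%N by exists (k - j.+1)%N; lia.
have -> : rbinom (k%:R - 2^-1 : R) j.+1 =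
    rbinom (k%:R - 2^-1 : R) j * ((k%:R - 2^-1 - j%:R) / j.+1%:R).
  rewrite /rbinom big_ord_recr /= factS natrM; field.
  by rewrite factR_neq0 addrC natr1 pnatr_eq0.
rewrite IHj ?(ltnW lejk) //.
have -> : (k - j = m.+1)%N by lia.
have -> : (k - j.+1 = m)%N by lia.
have -> : (2 * m.+1 = (2 * m).+2)%N by lia.
have -> : (2 * j.+1 = (2 * j).+2)%N by lia.
rewrite !factS !exprS !natrM km natrD -!natr1 natrM; field.
rewrite !factR_neq0 !natr1 !pnatr_eq0 -?natrM ?natr1 ?pnatr_eq0 /=.
by rewrite !expf_neq0 ?pnatr_eq0.
Qed.

Lemma eta_mul_bin (k j : nat) : (j <= k)%N ->
  eta R j k * 'C(k, j)%:R =
  rbinom (k%:R - 2^-1) j * rbinom (k%:R - 2^-1) (k - j).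
Proof.
move=> lejk; have [m km] : exists m, k = (j + m)%N by exists (k - j)%N; lia.
rewrite !rbinom_half ?leq_subr // /eta (subKn lejk).
have binE (a b : nat) : (b <= a)%N ->
    'C(a, b)%:R = a`!%:R / (b`!%:R * (a - b)`!%:R) :> R.
  move=> leba; apply: (canRL (mulfK _)); first by rewrite mulf_neq0.
  by rewrite -!natrM bin_fact.
have bin_neq0 : ('C(k, j)%:R : R) != 0 by rewrite pnatr_eq0 -lt0n bin_gt0.
have -> (x y z : R) : z != 0 -> x * y / (z * 'C(k, j)%:R) * 'C(k, j)%:R
    = x * y / z by move=> z0; field; rewrite z0 bin_neq0.
  rewrite !binE; [|lia|lia].
  have -> : (2 * k - 2 * j = 2 * (k - j))%N by lia.
  have -> : (2 * k - k = k)%N by lia.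
  have -> : (k - j = m)%N by lia.
  have -> : 2 ^+ (2 * k) = 2 ^+ (2 * j) * 2 ^+ (2 * m) :> R.
    by rewrite -exprD km mulnDr.
  by field; rewrite !factR_neq0 !expf_neq0 ?pnatr_eq0.
by rewrite expf_neq0 ?pnatr_eq0.
Qed.

End HalfInteger.

Section Bernstein.
Variable R : realType.

(** The factor [(x + (1 - x))^(n - k)] contributes ['C(n - k, l)] to the
    monomial [x^(j + l) (1 - x)^(n - j - l)], and [bernstein n (j + l)] is that
    monomial times ['C(n, j + l)], hence the division. *)
Lemma bernstein_elevation (n k j : nat) : (k <= n)%N -> (j <= k)%N ->
  bernstein R k j =
  \sum_(i < n.+1)
    (if (j <= i)%N then 'C(k, j)%:R * 'C(n - k, i - j)%:R / 'C(n, i)%:R else 0)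
    *: bernstein R n i.
Proof.
move=> lekn lejk.
have -> : bernstein R k j = \sum_(l < (n - k).+1)
    ('C(k, j)%:R * 'C(n - k, l)%:R)
      *: ('X^(j + l) * (1 - 'X) ^+ (n - (j + l))).
  rewrite /bernstein.
  rewrite (_ : 'X^j * _ = 'X^j * (1 - 'X) ^+ (k - j) * (1 - 'X + 'X) ^+ (n - k));
    last by rewrite subrK expr1n mulr1.
  rewrite [X in _ * X]exprDn mulr_sumr scaler_sumr.
  apply: eq_bigr => l _.
  have -> : (n - (j + l) = (k - j) + (n - k - l))%N.
    by have := ltn_ord l; lia.
  rewrite -scalerA; congr (_ *: _).
  by rewrite scaler_nat !exprD -mulr_natl -[in RHS]mulr_natl; ring.
rewrite -(big_mkord xpredT (fun l => ('C(k, j)%:R * 'C(n - k, l)%:R)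
  *: ('X^(j + l) * (1 - 'X) ^+ (n - (j + l))))).
rewrite -(big_mkord xpredT (fun i => (if (j <= i)%N
  then 'C(k, j)%:R * 'C(n - k, i - j)%:R / 'C(n, i)%:R else 0)
  *: bernstein R n i)).
(* Only the indices j <= i <= j + (n - k) contribute. *)
rewrite [RHS](big_cat_nat (n := j)) ?leq0n //=; last by lia.
rewrite [X in _ = X + _]big_nat_cond [X in _ = X + _]big1 ?add0r; last first.
  by move=> i /andP[/andP[_ ij] _]; rewrite leqNgt ij scale0r.
rewrite [RHS](big_cat_nat (n := (n - k).+1 + j)) /=; [|lia|lia].
rewrite [X in _ = _ + X]big_nat_cond [X in _ = _ + X]big1 ?addr0; last first.
  move=> i /andP[/andP[ij _] _].
  by rewrite [('C(n - k, _))%N]bin_small ?mulr0 ?mul0r ?if_same ?scale0r //; lia.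
rewrite -[X in _ = \sum_(X <= _ < _) _]add0n big_addn addnK.
rewrite big_nat_cond [RHS]big_nat_cond.
apply: eq_bigr => l /andP[/andP[_ ltl] _].
rewrite leq_addl addnK /bernstein scalerA [(l + j)%N]addnC divfK //.
by rewrite pnatr_eq0 -lt0n bin_gt0; lia.
Qed.

(** [bernstein n r] vanishes at [0] to order exactly [r], so comparing
    coefficients of increasing degree kills the [c i] one after another. *)
Lemma bernstein_free (n : nat) (c : 'I_n.+1 -> R) :
  \sum_(r < n.+1) c r *: bernstein R n r = 0 -> forall i, c i = 0.
Proof.
move=> c0 i; have [m] := ubnP (val i); elim: m i => // m IHm i ltim.
have := congr1 (fun q : {poly R} => q`_i) c0.
rewrite coef0 coef_sum (bigD1 i) //= big1 ?addr0; last first.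
  move=> r neqri; rewrite /bernstein !coefZ coefXnM.
  case: ltngtP => [_|ltri|/val_inj eqri]; first by rewrite !mulr0.
  - by rewrite IHm ?mul0r //; exact: leq_trans ltri ltim.
  - by rewrite eqri eqxx in neqri.
rewrite /bernstein !coefZ coefXnM ltnn subnn -horner_coef0 horner_exp.
rewrite hornerD hornerN hornerX hornerC subr0 expr1n mulr1.
move=> /eqP; rewrite mulf_eq0 => /orP[/eqP //|].
by rewrite pnatr_eq0 -leqn0 leqNgt bin_gt0 -ltnS ltn_ord.
Qed.

(** The points [1 / (m + 1)] would be too many roots for a nonzero
    difference. *)
Lemma eq_poly01 (p q : {poly R}) :
  (forall x, 0 <= x <= 1 -> p.[x] = q.[x]) -> p = q.
Proof.
move=> eqpq; apply/eqP; rewrite -subr_eq0; apply/negPn/negP => pq0.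
pose s := [seq (m.+1%:R : R)^-1 | m <- iota 0 (size (p - q))].
have roots : all (root (p - q)) s.
  apply/allP => _ /mapP[m _ ->].
  rewrite rootE hornerD hornerN eqpq ?subrr //.
  by rewrite invr_ge0 ler0n invf_le1 ?ltr0n // ler1n.
have uniqs : uniq s.
  rewrite map_inj_uniq ?iota_uniq // => a b /invr_inj /eqP.
  by rewrite eqr_nat eqSS => /eqP.
by have := max_poly_roots pq0 roots uniqs; rewrite size_map size_iota ltnn.
Qed.

Lemma chebT_bernstein (n k : nat) : (k <= n)%N ->
  chebT R k = \sum_(i < n.+1)
    ('C(n, i)%:R^-1 * \sum_(i + k - n <= j < (minn i k).+1)
       (-1) ^+ (k - j) * 'C(n - k, i - j)%:R
       * rbinom (k%:R - 2^-1) j * rbinom (k%:R - 2^-1) (k - j))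
    *: bernstein R n i.
Proof.
move=> lekn; rewrite /chebT.
under eq_bigr => j _.
  rewrite (bernstein_elevation _ _ _ lekn (ltn_ord j)) scaler_sumr.
  under eq_bigr do rewrite scalerA.
  over.
rewrite exchange_big /=; apply: eq_bigr => i _.
rewrite -scaler_suml; congr (_ *: _).
rewrite mulr_sumr; set F := fun j : nat => (-1) ^+ (k - j) * eta R j k *
  (if (j <= i)%N then 'C(k, j)%:R * 'C(n - k, i - j)%:R / 'C(n, i)%:R else 0).
rewrite -(big_mkord xpredT F).
have lein : (i <= n)%N by rewrite -ltnS.
(* Outside the range of the inner sum, j > i or 'C(n - k, i - j) = 0. *)
rewrite (big_cat_nat (n := i + k - n)) ?leq0n //=; last by lia.
rewrite [X in X + _]big_nat_cond [X in X + _]big1 ?add0r; last first.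
  move=> j /andP[/andP[_ ltj] _].
  by rewrite /F [('C(n - k, _))%N]bin_small ?mulr0 ?mul0r ?if_same ?mulr0 //; lia.
rewrite (big_cat_nat (n := (minn i k).+1)) /=; [|lia|lia].
rewrite [X in _ + X]big_nat_cond [X in _ + X]big1 ?addr0; last first.
  move=> j /andP[/andP[ltj ltjk] _].
  by rewrite /F ifF ?mulr0 //; lia.
rewrite big_nat_cond [RHS]big_nat_cond.
apply: eq_bigr => j /andP[/andP[_ ltj] _].
have [leji lejk] : (j <= i)%N /\ (j <= k)%N by lia.
by rewrite /F leji -[_ * _ * rbinom _ _ * _]mulrA -eta_mul_bin //; ring.
Qed.

Lemma gchebT_bernstein (M N : R) (n : nat) (r : 'I_n.+1) :
  gchebT M N r = \sum_(i < n.+1) transmx M N n i r *: bernstein R n i.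
Proof.
have lern : (r <= n)%N by rewrite -ltnS.
rewrite /gchebT (chebT_bernstein n r lern) scaler_sumr.
under [X in _ + X]eq_bigr => k _.
  rewrite (chebT_bernstein n k (leq_trans (leq_ord k) lern)) scaler_sumr.
  over.
rewrite [X in _ + X]exchange_big -big_split /=; apply: eq_bigr => i _.
rewrite mxE scalerDl scaler_suml scalerA; congr (_ *: _ + _).
  rewrite mulrCA mulrA; congr (_ * _ * _).
  rewrite /odddfact /evendfact mul2n -addnn exprD.
  by field; rewrite expf_neq0 ?pnatr_eq0 // -lt0n fact_gt0.
apply: eq_bigr => k _; rewrite scalerA; congr (_ *: _).
by ring.
Qed.

End Bernstein.

Theorem theorem2p1 (R : realType) (M N : R) (hM : 0 <= M) (hN : 0 <= N)
    (n : nat) (p : {poly R}) (d c : 'I_n.+1 -> R)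
    (hd : forall x : R, 0 <= x <= 1 ->
      p.[x] = \sum_(i < n.+1) d i * (gchebT M N i).[x])
    (hc : forall x : R, 0 <= x <= 1 ->
      p.[x] = \sum_(r < n.+1) c r * (bernstein R n r).[x]) :
  forall i : 'I_n.+1, c i = \sum_(r < n.+1) transmx M N n i r * d r.
Proof.
move=> i; apply/eqP; rewrite -subr_eq0; apply/eqP; move: i.
apply: bernstein_free.
under eq_bigr do rewrite scalerBl.
rewrite sumrB; apply/eqP; rewrite subr_eq0; apply/eqP.
have -> : \sum_(i < n.+1) (\sum_(r < n.+1) transmx M N n i r * d r)
    *: bernstein R n i = \sum_(r < n.+1) d r *: gchebT M N r.
  under eq_bigr do rewrite scaler_suml.
  rewrite exchange_big; apply: eq_bigr => r _.
  rewrite gchebT_bernstein scaler_sumr; apply: eq_bigr => i _.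
  by rewrite scalerA mulrC.
apply: eq_poly01 => x x01; rewrite !horner_sum.
under eq_bigr do rewrite hornerZ.
under [RHS]eq_bigr do rewrite hornerZ.
by rewrite -hc // hd.
Qed.
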